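(* There exist a weighted digraph $G$ and a subdivision $S:E(G)\to\bigsqcup_{d\in\mathbb N}\mathrm{int}(\Delta^d)$ such that, with $G_S$ denoting the subdivision of $G$ by $S$, $$d_I\big((H\circ\mathrm{dFl})(\mathrm{SP}(G)),\,(H\circ\mathrm{dFl})(\mathrm{SP}(G_S))\big)=\infty.$$
   Context: All digraphs are simple (no self-loops; reciprocal edges allowed). A weighted digraph is $G=(V,E,w)$ with $(V,E)$ a digraph and $w:E\to(0,\infty)$. A path $s_0\leadsto t_k$ is a (non-empty) sequence of edges $e_i=(s_i,t_i)$, $0\le i\le k$, with $s_{i+1}=t_i$; its length is $\sum_iw(e_i)$. The shortest-path filtration $\mathrm{SP}(G)$ is the family of digraphs $\mathrm{SP}(G)_t$, $t\in\mathbb R$, on $V(G)$, with an edge $(i,j)$, $i\ne j$, iff there is a path $i\leadsto j$ of length $\le t$; with inclusions it is a functor from the poset $(\mathbb R,\le)$ to digraphs. A subdivision is a map $S:F\to\bigsqcup_{d\in\mathbb N}\mathrm{int}(\Delta^d)$ from a subset $F\subseteq E(G)$ (here $F=E(G)$) to the disjoint union of interiors of standard simplices. For $e\in F$ let $d(e)$ be such that $S(e)\in\mathrm{int}(\Delta^{d(e)})$, with components $S(e)_0,\dots,S(e)_{d(e)}$. The subdivision of $G$ by $S$ is the weighted digraph $G_S$ with vertices $V(G)\sqcup\bigsqcup_{e\in F}\{v_{e,1},\dots,v_{e,d(e)}\}$, edges $(E(G)\setminus F)\sqcup\bigsqcup_{e\in F}\{\tau_{e,0},\dots,\tau_{e,d(e)}\}$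 where $\tau_{e,i}=(v_{e,i},v_{e,i+1})$, with $v_{e,0}$ and $v_{e,d(e)+1}$ the source and target of $e$, and weights $w(\tau)$ for $\tau\in E(G)\setminus F$ and $S(e)_i\cdot w(e)$ for $\tau_{e,i}$. Fix a field $\mathbb F$. A directed $k$-clique is a $k$-tuple $v_0\dots v_{k-1}$ of distinct vertices with $v_i\to v_j$ whenever $i<j$. The directed flag complex $\mathrm{dFl}(G)$ has chain complex with basis in degree $k$ the directed $(k+1)$-cliques and $\partial(v_0\dots v_k)=\sum_i(-1)^iv_0\dots\hat{v_i}\dots v_k$ ($\partial_0=0$); $(H\circ\mathrm{dFl})(G)$ is its homology in all degrees, a graded $\mathbb F$-vector space, functorial for inclusions of digraphs. Applying this to $\mathrm{SP}(G)$ at each $t$ gives a functor from $(\mathbb R,\le)$ to graded vector spaces. For functors $M,N:(\mathbb R,\le)\to\mathcal C$ and $\delta\ge0$, let $M^\delta(t)=M(t+\delta)$, and let $T_M^\delta:M\Rightarrow M^\delta$ have components $M(t\le t+\delta)$. $M,N$ are $\delta$-interleaved if there are natural transformations $f:M\Rightarrow N^\delta$, $g:N\Rightarrow M^\delta$ with $g^\delta\circ f=T_M^{2\delta}$ and $f^\delta\circ g=T_N^{2\delta}$. $d_I(M,N)=\inf\{\delta\ge0:M,N\text{ are }\delta\text{-interleaved}\}\in[0,\infty]$, with $\inf\emptyset=\infty$. *)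

(* Defs.v *)
From HB Require Import structures.
From mathcomp Require Import all_boot all_order all_algebra.
From mathcomp Require Import generic_quotient ring_quotient freeg.
From mathcomp Require Import boolp classical_sets constructive_ereal reals ereal.

Set Implicit Arguments.
Unset Strict Implicit.
Unset Printing Implicit Defensive.

Import Order.TTheory GRing.Theory Num.Theory.
Local Open Scope ring_scope.

Section QuotLmodule.
Variables (F : fieldType) (V : lmodType F) (B : submodClosed V).
Local Open Scope quotient_scope.

(* the library does not derive closure under opposite for submodClosed *)
Definition submod_pred : {pred V} := B.

Fact submod_pred_zmod_closed : zmod_closed submod_pred.
Proof.
split; first exact: rpred0.
by move=> x y xB yB; rewrite -scaleN1r; apply: rpredD => //; apply: rpredZ.
Qed.
HB.instance Definition _ :=
  GRing.isZmodClosed.Build V submod_pred submod_pred_zmod_closed.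

Definition quot_lmod := Quotient.quot submod_pred.

HB.instance Definition _ := GRing.Zmodule.on quot_lmod.

Definition qproj (x : V) : quot_lmod := \pi_(Quotient.quot submod_pred) x.

Lemma qproj_eq x y : (qproj x == qproj y) = (x - y \in B).
Proof. by have := Quotient.idealrBE submod_pred x y; rewrite -topredE /= => <-. Qed.

Lemma qproj_repr (q : quot_lmod) : qproj (repr q) = q.
Proof. exact: reprK. Qed.

Lemma qproj_zmod_morphism : zmod_morphism qproj.
Proof. by move=> x y; rewrite /qproj; exact: (raddfB (\pi_(Quotient.quot submod_pred))). Qed.

Definition qscale (a : F) (q : quot_lmod) : quot_lmod := qproj (a *: repr q).

Lemma qscaleE a x : qscale a (qproj x) = qproj (a *: x).
Proof.
apply/eqP; rewrite qproj_eq -scalerBr; apply: rpredZ; rewrite -qproj_eq.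
by rewrite qproj_repr.
Qed.

Lemma qprojD x y : qproj (x + y) = qproj x + qproj y.
Proof. exact: (raddfD (\pi_(Quotient.quot submod_pred))). Qed.

Fact qscaleA a b q : qscale a (qscale b q) = qscale (a * b) q.
Proof. by rewrite -[q]qproj_repr !qscaleE scalerA. Qed.

Fact qscale1 : left_id 1 qscale.
Proof. by move=> q; rewrite -[q]qproj_repr qscaleE scale1r. Qed.

Fact qscaleDr : right_distributive qscale +%R.
Proof.
move=> a q r; rewrite -[q]qproj_repr -[r]qproj_repr.
by rewrite -qprojD !qscaleE scalerDr qprojD.
Qed.

Fact qscaleDl q : {morph qscale^~ q : a b / a + b}.
Proof.
by move=> a b; rewrite -[q]qproj_repr !qscaleE scalerDl qprojD.
Qed.

HB.instance Definition _ :=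
  GRing.Zmodule_isLmodule.Build F quot_lmod qscaleA qscale1 qscaleDr qscaleDl.

Fact qproj_scalable : scalable qproj.
Proof. by move=> a x; rewrite -qscaleE. Qed.

HB.instance Definition _ :=
  GRing.isZmodMorphism.Build V quot_lmod qproj qproj_zmod_morphism.
HB.instance Definition _ :=
  GRing.isScalable.Build F V quot_lmod *:%R qproj qproj_scalable.

End QuotLmodule.

Record complex (F : fieldType) := Complex {
  chain : nat -> lmodType F;
  bd : forall k, {linear chain k -> chain k.-1};
  bd0 : forall x, bd 0 x = 0;
  bdK : forall k x, bd k (bd k.+1 x) = 0 }.

Record chain_map (F : fieldType) (C D : complex F) := ChainMap {
  cmap :> forall k, {linear chain C k -> chain D k};
  cmap_bd : forall k x, cmap k.-1 (bd C k x) = bd D k (cmap k x) }.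

Section Homology.
Variables (F : fieldType) (C : complex F) (k : nat).

Definition is_cycle : {pred chain C k} := fun x => bd C k x == 0.

Fact is_cycle_closed : submod_closed is_cycle.
Proof.
split; first by rewrite unfold_in linear0.
by move=> a x y; rewrite !unfold_in linearP => /eqP-> /eqP->; rewrite scaler0 addr0.
Qed.
HB.instance Definition _ :=
  GRing.isSubmodClosed.Build F (chain C k) is_cycle is_cycle_closed.

Definition cycle := {x : chain C k | is_cycle x}.
HB.instance Definition _ := SubType.on cycle.
HB.instance Definition _ := Choice.on cycle.
HB.instance Definition _ := [SubChoice_isSubLmodule of cycle by <:].

Definition is_boundary : {pred cycle} :=
  fun z => `[< exists c : chain C k.+1, bd C k.+1 c = val z >].

Fact is_boundary_closed : submod_closed is_boundary.
Proof.
split; first by apply/asboolP; exists 0; rewrite !linear0.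
move=> a x y /asboolP[c cx] /asboolP[d dy]; apply/asboolP.
by exists (a *: c + d); rewrite !linearP /= cx dy.
Qed.
HB.instance Definition _ :=
  GRing.isSubmodClosed.Build F cycle is_boundary is_boundary_closed.

Definition homology : lmodType F := quot_lmod is_boundary.

Definition hclass (z : cycle) : homology := qproj is_boundary z.

HB.instance Definition _ := GRing.Linear.copy hclass (qproj is_boundary).

Lemma hclassP (h : homology) : exists z, h = hclass z.
Proof. by exists (repr h); rewrite /hclass qproj_repr. Qed.

Lemma hclass_eq0 z : hclass z = 0 <-> exists c, bd C k.+1 c = val z.
Proof.
rewrite -(linear0 hclass); split=> [/eqP|H].
  by rewrite qproj_eq subr0 => /asboolP.
by apply/eqP; rewrite qproj_eq subr0; apply/asboolP.
Qed.

End Homology.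

Section HomologyMap.
Variables (F : fieldType) (C D : complex F) (f : chain_map C D) (k : nat).

Fact cycle_map_subproof (z : cycle C k) : is_cycle (f k (val z)).
Proof. by rewrite /is_cycle -cmap_bd (eqP (valP z)) linear0. Qed.

Definition cycle_map (z : cycle C k) : cycle D k :=
  Sub (f k (val z)) (cycle_map_subproof z).

Fact cycle_map_linear : linear cycle_map.
Proof. by move=> a x y; apply/val_inj; rewrite /= !linearP. Qed.
HB.instance Definition _ :=
  GRing.isLinear.Build F (cycle C k) (cycle D k) *:%R cycle_map cycle_map_linear.

Definition homology_map (h : homology C k) : homology D k :=
  hclass (cycle_map (repr h)).

Lemma homology_mapE z : homology_map (hclass z) = hclass (cycle_map z).
Proof.
have /hclass_eq0[c cE] : hclass (repr (hclass z) - z) = 0.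
  by rewrite linearB /= /hclass qproj_repr subrr.
apply/eqP; rewrite -subr_eq0 -!linearB; apply/eqP/hclass_eq0.
by exists (f k.+1 c); rewrite -cmap_bd cE.
Qed.

Fact homology_map_linear : linear homology_map.
Proof.
move=> a x y; have [[u ->] [v ->]] := (hclassP x, hclassP y).
by rewrite -linearP !homology_mapE -linearP -[in RHS]linearP.
Qed.
HB.instance Definition _ := GRing.isLinear.Build
  F (homology C k) (homology D k) *:%R homology_map homology_map_linear.

End HomologyMap.

(* V is a choiceType only so that {freeg _ / F} applies; it may be infinite. *)
Record digraph (V : choiceType) := Digraph {
  arc :> rel V;
  arc_irr : irreflexive arc }.

Definition subdigraph (V : choiceType) (G H : digraph V) := subrel G H.

Section Clique.
Variables (V : choiceType) (G : digraph V).

Definition is_clique k (v : {ffun 'I_k -> V}) :=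
  injectiveb v && [forall i : 'I_k, forall j : 'I_k, (i < j)%N ==> G (v i) (v j)].

Definition clique k := {v : {ffun 'I_k -> V} | is_clique v}.
HB.instance Definition _ k := SubType.on (clique k).
HB.instance Definition _ k := Choice.on (clique k).

Fact face_subproof k (i : 'I_k.+1) (v : clique k.+1) :
  is_clique [ffun j : 'I_k => val v (fintype.lift i j)].
Proof.
have /andP[/injectiveP vI /forallP vG] := valP v.
apply/andP; split.
  by apply/injectiveP => a b; rewrite !ffunE => /vI/lift_inj.
apply/forallP => a; apply/forallP => b; apply/implyP => ab; rewrite !ffunE.
have /implyP := forallP (vG (fintype.lift i a)) (fintype.lift i b); apply.
rewrite /= /bump; case: (leqP i a) => ia; case: (leqP i b) => ib.
- by rewrite !add1n ltnS.
- by have := leq_trans ib (leq_trans ia (ltnW ab)); rewrite ltnn.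
- by rewrite add0n add1n ltnS ltnW.
- by rewrite !add0n.
Qed.

Definition face k (i : 'I_k.+1) (v : clique k.+1) : clique k :=
  Sub [ffun j : 'I_k => val v (fintype.lift i j)] (face_subproof i v).

End Clique.

Section FreeMap.
Variables (F : fieldType) (K : choiceType) (M : lmodType F).

Fact fglift_linear (f : K -> M) : linear (fglift f).
Proof.
pose A := GRing.isZmodMorphism.Build _ _ (fglift f) (lift_is_additive f).
pose g : {additive {freeg K / F} -> M} := HB.pack (fglift f) A.
have gE D : g D = fglift f D by [].
move=> a D E; rewrite -gE raddfD /=; congr (_ + _).
rewrite {1}/GRing.scale /= /fgscale -gE raddf_sum -[in RHS](freeg_sumE D).
rewrite -[in RHS]gE raddf_sum scaler_sumr; apply: eq_bigr => x _.
by rewrite /= !liftU scalerA.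
Qed.
HB.instance Definition _ (f : K -> M) := GRing.isLinear.Build
  F {freeg K / F} M *:%R (fglift f) (fglift_linear f).

Lemma freeg_linear_ext (f g : {linear {freeg K / F} -> M}) :
  (forall x, f << x >> = g << x >>) -> f =1 g.
Proof.
move=> fg D; rewrite -(freeg_sumE D) !linear_sum; apply: eq_bigr => x _.
have -> : << coeff x D *g x >> = coeff x D *: << x >> :> {freeg K / F}.
  by apply/eqP/freeg_eqP => y; rewrite coeffZ !coeffU mul1r.
by rewrite !linearZ /= fg.
Qed.
End FreeMap.

Section FlagComplex.
Variables (F : fieldType) (V : choiceType) (G : digraph V).

Definition flag_chain k : lmodType F := {freeg (clique G k.+1) / F}.

Definition flag_face_sum k (v : clique G k.+2) : flag_chain k :=
  \sum_(i < k.+2) (-1) ^+ i *: << face i v >>.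

Definition flag_bd k : {linear flag_chain k -> flag_chain k.-1} :=
  match k with
  | 0 => \0
  | k'.+1 => fglift (@flag_face_sum k')
  end.

Fact flag_bd0 x : flag_bd 0 x = 0. Proof. by []. Qed.

Lemma face_comm k (v : clique G k.+2) (i : 'I_k.+2) (j : 'I_k.+1) : (j < i)%N ->
  face j (face i v) = face (inord i.-1) (face (inord j) v).
Proof.
move=> ji; have i_gt0 : (0 < i)%N by exact: leq_ltn_trans ji.
apply/val_inj/ffunP => x; rewrite /= !ffunE; congr (val v _); apply/val_inj.
rewrite /= !inordK; last 2 first.
- by rewrite prednK // -ltnS ltn_ord.
- exact: ltnW (ltn_ord j).
have bij : bump i j = j by rewrite /bump leqNgt ji.
by rewrite bumpC bij /unbump ji subn1.
Qed.

Fact flag_bdK k x : flag_bd k (flag_bd k.+1 x) = 0.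
Proof.
case: k x => [|k] x //.
pose d2 : {linear flag_chain k.+2 -> flag_chain k} := flag_bd k.+1 \o flag_bd k.+2.
apply: (@freeg_linear_ext _ _ _ d2 \0) => {x} v.
rewrite /d2 /= liftU scale1r linear_sum /=.
under eq_bigr => i _.
  rewrite linearZ /= liftU scale1r scaler_sumr.
  under eq_bigr => j _ do rewrite scalerA -exprD.
  over.
rewrite pair_big /= (bigID (fun p : 'I_k.+3 * 'I_k.+2 => p.2 < p.1)%N) /=.
pose h (p : 'I_k.+3 * 'I_k.+2) : 'I_k.+3 * 'I_k.+2 := (inord p.2, inord p.1.-1).
pose h' (p : 'I_k.+3 * 'I_k.+2) : 'I_k.+3 * 'I_k.+2 := (inord p.2.+1, inord p.1).
rewrite [X in _ + X](reindex_onto h h') /=; last first.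
  move=> [i j] /=; rewrite -leqNgt => ij; rewrite /h /h' /=.
  congr pair; apply/val_inj => /=; rewrite !inordK //=.
  - exact: leq_ltn_trans ij (ltn_ord j).
  - exact: leq_ltn_trans ij (ltn_ord j).
  - exact: ltn_ord j.
  - exact: ltn_ord j.
pose A (p : 'I_k.+3 * 'I_k.+2) : flag_chain k :=
  (-1) ^+ (p.1 + p.2) *: << face p.2 (face p.1 v) >>.
rewrite [X in _ + X]
    (eq_big (fun p : 'I_k.+3 * 'I_k.+2 => p.2 < p.1)%N (fun p => - A p)) => [|p|p].
- by rewrite sumrN subrr.
- case: p => i j; rewrite /h' /h /=.
  have i1 : (i.-1 < k.+2)%N by case: (i : nat) (ltn_ord i).
  rewrite !(inordK i1) (inordK (ltnW (ltn_ord j) : j < k.+3)%N) inord_val.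
  case: (posnP i) => [i0|i_gt0].
    rewrite [in RHS]i0 ltn0; apply/negP => /andP[_ /eqP[/(congr1 val)]].
    by rewrite /= inordK i0.
  by rewrite prednK // inord_val eqxx andbT ltnNge.
case: p => i j; rewrite /h' /h /= => /andP[+ hp].
have i1 : (i.-1 < k.+2)%N by case: (i : nat) (ltn_ord i).
rewrite (inordK i1) (inordK (ltnW (ltn_ord j) : j < k.+3)%N) -leqNgt => ji.
have i_gt0 : (0 < i)%N.
  rewrite lt0n; apply: contraTneq hp => i0.
  apply/negP => /eqP[/(congr1 val)].
  by rewrite /= (inordK i1) inordK i0.
have ji' : (j < i)%N by rewrite -(prednK i_gt0) ltnS.
rewrite -(face_comm v ji') /A /= [(j + _)%N]addnC.
by rewrite -[in RHS](prednK i_gt0) addSn exprS mulN1r scaleNr opprK.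
Qed.

Definition dFl : complex F := Complex flag_bd0 flag_bdK.

End FlagComplex.

Section FlagInclusion.
Variables (F : fieldType) (V : choiceType) (G H : digraph V).
Hypothesis GH : subdigraph G H.

Fact clique_incl_subproof k (v : clique G k) : is_clique H (val v).
Proof.
have /andP[vI /forallP vG] := valP v; rewrite /is_clique vI /=.
apply/forallP => i; apply/forallP => j; apply/implyP => ij; apply: GH.
by have /implyP := forallP (vG i) j; apply.
Qed.

Definition clique_incl k (v : clique G k) : clique H k :=
  Sub (val v) (clique_incl_subproof v).

Definition flag_incl k : {linear flag_chain F G k -> flag_chain F H k} :=
  fglift (fun v : clique G k.+1 => << clique_incl v >> : flag_chain F H k).

Fact flag_incl_bd k x :
  flag_incl k.-1 (flag_bd F G k x) = flag_bd F H k (flag_incl k x).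
Proof.
case: k x => [|k] x; first by rewrite /= linear0.
apply: (@freeg_linear_ext _ _ _ (flag_incl k \o flag_bd F G k.+1)
                                (flag_bd F H k.+1 \o flag_incl k.+1)) => {x} v.
rewrite /= !liftU !scale1r linear_sum /= liftU scale1r; apply: eq_bigr => i _.
rewrite linearZ /= liftU scale1r; congr (_ *: << _ >>).
exact/val_inj.
Qed.

Definition dFl_incl : chain_map (dFl F G) (dFl F H) :=
  @ChainMap F (dFl F G) (dFl F H) flag_incl flag_incl_bd.

End FlagInclusion.

Section Persistence.
Variables (R : realType) (F : fieldType).

(* functor from the poset (R, <=) to N-graded vector spaces *)
Record pers := Pers {
  pobj :> R -> nat -> lmodType F;
  pmap : forall s t, s <= t -> forall k, {linear pobj s k -> pobj t k};
  pmap_id : forall t (h : t <= t) k x, pmap h k x = x;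
  pmap_comp : forall r s t (rs : r <= s) (st : s <= t) (rt : r <= t) k x,
    pmap st k (pmap rs k x) = pmap rt k x }.

(* natural transformations from M to the shift t |-> N (t + delta) *)
Record shift_hom (delta : R) (M N : pers) := ShiftHom {
  shom :> forall t k, {linear M t k -> N (t + delta) k};
  shom_nat : forall s t (st : s <= t) (st' : s + delta <= t + delta) k x,
    shom t k (pmap M st k x) = pmap N st' k (shom s k x) }.

(* The 2 delta shift is taken at t + delta + delta, which is where the
   components of the composites land definitionally. *)
Definition interleaved (delta : R) (M N : pers) : Prop :=
  exists (f : shift_hom delta M N) (g : shift_hom delta N M),
    (forall t (h : t <= t + delta + delta) k x,
       g (t + delta) k (f t k x) = pmap M h k x) /\
    (forall t (h : t <= t + delta + delta) k x,
       f (t + delta) k (g t k x) = pmap N h k x).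

Definition dI (M N : pers) : \bar R :=
  ereal_inf [set delta%:E | delta in
               [set delta : R | 0 <= delta /\ interleaved delta M N]].

End Persistence.

Record filtration (R : realType) (V : choiceType) := Filtration {
  fdigraph :> R -> digraph V;
  fdigraph_incl : forall s t, s <= t -> subdigraph (fdigraph s) (fdigraph t) }.

Arguments fdigraph_incl {R V} f {s t} st.

Section HdFl.
Variables (R : realType) (F : fieldType) (V : choiceType) (X : filtration R V).

Definition HdFl_map s t (st : s <= t) k :
    {linear homology (dFl F (X s)) k -> homology (dFl F (X t)) k} :=
  @homology_map _ _ _ (dFl_incl F (fdigraph_incl X st)) k.

Fact HdFl_id t (h : t <= t) k x : HdFl_map h k x = x.
Proof.
have [z ->] := hclassP x; rewrite /HdFl_map /= homology_mapE.
congr hclass; apply/val_inj => /=.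
apply: (@freeg_linear_ext _ _ _ (flag_incl F (fdigraph_incl X h) k) idfun) => v.
by rewrite /= liftU scale1r (_ : clique_incl _ v = v) //; exact/val_inj.
Qed.

Fact HdFl_comp r s t (rs : r <= s) (st : s <= t) (rt : r <= t) k x :
  HdFl_map st k (HdFl_map rs k x) = HdFl_map rt k x.
Proof.
have [z ->] := hclassP x; rewrite /HdFl_map /= !homology_mapE.
congr hclass; apply/val_inj => /=.
apply: (@freeg_linear_ext _ _ _
  (flag_incl F (fdigraph_incl X st) k \o flag_incl F (fdigraph_incl X rs) k)
  (flag_incl F (fdigraph_incl X rt) k)) => v.
by rewrite /= !(liftU, scale1r); congr (<< _ >>); exact/val_inj.
Qed.

Definition HdFl : pers R F := Pers HdFl_id HdFl_comp.

End HdFl.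

(* The edge set is presented by a type with source and target maps that embeds
   into the ordered pairs of distinct vertices. *)
Record wdigraph (R : realType) := WDigraph {
  vertex : choiceType;
  edge : choiceType;
  src : edge -> vertex;
  tgt : edge -> vertex;
  edge_inj : injective (fun e => (src e, tgt e));
  edge_loopless : forall e, src e != tgt e;
  weight : edge -> R;
  weight_gt0 : forall e, 0 < weight e }.

Section ShortestPath.
Variables (R : realType) (G : wdigraph R).

(* e :: p is a path from x to y; writing the first edge apart makes it nonempty *)
Definition is_path (x y : vertex G) (e : edge G) (p : seq (edge G)) :=
  [&& src e == x, path (fun e1 e2 => tgt e1 == src e2) e p & tgt (last e p) == y].

Definition path_length (p : seq (edge G)) : R := \sum_(e <- p) weight e.

Definition SP_arc (t : R) (x y : vertex G) : bool :=
  (x != y) &&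
  `[< exists e p, is_path x y e p /\ path_length (e :: p) <= t >].

Fact SP_irr t : irreflexive (SP_arc t).
Proof. by move=> x; rewrite /SP_arc eqxx. Qed.

Definition SP_digraph t : digraph (vertex G) := Digraph (@SP_irr t).

Fact SP_incl s t : s <= t -> subdigraph (SP_digraph s) (SP_digraph t).
Proof.
move=> st x y /andP[xy /asboolP[e [p [ep ps]]]]; apply/andP; split=> //.
by apply/asboolP; exists e, p; split=> //; exact: le_trans st.
Qed.

Definition SP : filtration R (vertex G) := Filtration SP_incl.

End ShortestPath.

(* interior of the standard d-simplex, in barycentric coordinates *)
Definition int_simplex (R : realType) (d : nat) : Type :=
  {s : 'I_d.+1 -> R | (forall i, 0 < s i) /\ \sum_i s i = 1}.

Definition subdivision (R : realType) (G : wdigraph R) : Type :=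
  edge G -> {d : nat & int_simplex R d}.

Section Subdivide.
Variables (R : realType) (G : wdigraph R) (S : subdivision G).

Definition sdim (e : edge G) : nat := projT1 (S e).
Definition scoord (e : edge G) : 'I_(sdim e).+1 -> R := sval (projT2 (S e)).

(* inr (Tagged _ j) in the fibre of e is v_{e, j + 1} *)
Definition sub_vertex : choiceType := (vertex G + {e : edge G & 'I_(sdim e)})%type.

(* v_{e, i} for 0 <= i <= sdim e + 1 *)
Definition sub_v (e : edge G) (i : nat) : sub_vertex :=
  if i is j.+1 then
    if insub j is Some j' then inr (Tagged (fun e => 'I_(sdim e)) (j' : 'I_(sdim e)))
    else inl (tgt e)
  else inl (src e).

(* Tagged _ i in the fibre of e is tau_{e, i} *)
Definition sub_edge : choiceType := {e : edge G & 'I_(sdim e).+1}.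

Definition sub_src (tau : sub_edge) : sub_vertex := sub_v (tag tau) (tagged tau).
Definition sub_tgt (tau : sub_edge) : sub_vertex := sub_v (tag tau) (tagged tau).+1.
Definition sub_weight (tau : sub_edge) : R :=
  scoord (tagged tau) * weight (tag tau).

Lemma sub_v0 e : sub_v e 0 = inl (src e). Proof. by []. Qed.

Lemma sub_vS e (j : 'I_(sdim e)) :
  sub_v e j.+1 = inr (Tagged (fun e => 'I_(sdim e)) j).
Proof. by rewrite /= valK. Qed.

Lemma sub_v_last e : sub_v e (sdim e).+1 = inl (tgt e).
Proof. by rewrite /= insubF // ltnn. Qed.

Fact sub_edge_inj : injective (fun tau => (sub_src tau, sub_tgt tau)).
Proof.
move=> [e i] [e' i'] /= []; rewrite /sub_src /sub_tgt /= => Hs Ht.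
suff ee' : e = e' /\ i = i' :> nat.
  case: ee' => E; subst e'.
  by move=> ii'; congr (existT _ e _); exact/val_inj.
case: i i' Hs Ht => [[|i] iP] [[|i'] i'P] /=.
- move=> [ss]; case: insubP => [u _ uE|_]; case: insubP => [u' _ u'E|_] // [H].
    by [].
  by split=> //; apply: edge_inj; rewrite ss H.
- by case: insubP => // /negP[].
- by case: insubP => // /negP[].
- case: insubP => [u _ uE|]; last by rewrite -ltnS iP.
  case: insubP => [u' _ u'E|]; last by rewrite -ltnS i'P.
  pose g (x : sub_vertex) := if x is inr w then Some (tag w, val (tagged w)) else None.
  by move=> /(congr1 g)[ee' /= uu'] _; split=> //;
    congr _.+1; exact: etrans (esym uE) (etrans uu' u'E).
Qed.

Fact sub_edge_loopless tau : sub_src tau != sub_tgt tau.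
Proof.
case: tau => e [i iP]; rewrite /sub_src /sub_tgt /=; apply/eqP.
case: i iP => [|i] iP.
  rewrite /sub_v; case: insubP => //= _ [] se.
  by have := edge_loopless e; rewrite se eqxx.
rewrite /sub_v; case: insubP => [u _ uE|]; last by rewrite -ltnS iP.
case: insubP => [u' _ u'E|] // E.
pose g (x : sub_vertex) := if x is inr w then val (tagged w) else 0%N.
have /= := congr1 g E; rewrite uE u'E => /eqP.
by rewrite ltn_eqF.
Qed.

Fact sub_weight_gt0 tau : 0 < sub_weight tau.
Proof.
by rewrite mulr_gt0 ?weight_gt0 // /scoord; have [] := svalP (projT2 (S (tag tau))).
Qed.

Definition subdivide : wdigraph R :=
  WDigraph sub_edge_inj sub_edge_loopless sub_weight_gt0.

End Subdivide.

(* Main.v *)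
Require Import Defs.
From mathcomp Require Import all_boot all_order all_algebra.
From mathcomp Require Import constructive_ereal reals.
From mathcomp Require Import freeg boolp classical_sets ereal.

(** The graph [G] is the 2-cycle on vertices [false] and [true] with unit
    weights, and [S] inserts one vertex in the middle of one of its two edges,
    so that the subdivision is a 3-cycle.  In both graphs every vertex reaches
    every other one, so for large times the filtrations are the complete
    digraphs on 2 and on 3 vertices: a subdivision does not preserve the number
    of vertices, and the directed flag complex of a complete digraph (the
    complex of injective words) depends on that number.

    Degree 2 tells them apart.  On two vertices there is no 3-clique, so the
    degree 2 homology of [SP G] vanishes at all times ([flag_homology_eq0]).
    On three mutually adjacent vertices [a], [b], [c] the directed flag complex
    contains a sphere obtained by suspending the circle [bc + cb], the vertex
    [a] being used both as the initial cone point and as the terminal one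
    ([suspension_bd]).  There are no 4-cliques on three vertices, hence
    no nonzero boundary in degree 2; as the suspension is a nonzero chain
    ([suspension_neq0]) that later inclusions preserve
    ([flag_incl_suspension]), its class survives for ever.  An interleaving of
    any finite size would factor the image of this class, at a later time,
    through a zero space ([dI_pinfty]). *)

Set Implicit Arguments.
Unset Strict Implicit.
Unset Printing Implicit Defensive.

Import Order.TTheory GRing.Theory Num.Theory.
Local Open Scope ring_scope.

(** * An obstruction to interleaving *)

(** For every [delta], the structure map of [N] from [t] to
    [t + delta + delta] would factor through [M (t + delta)], which is zero in
    degree [k]. *)
Lemma dI_pinfty (R : realType) (F : fieldType) (M N : pers R F) (k : nat)
    (t : R) (x : N t k) :
  (forall s (y : M s k), y = 0) ->
  (forall s (ts : t <= s), Defs.pmap N ts k x != 0) ->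
  dI M N = +oo%E.
Proof.
move=> M0 x_persists; rewrite /dI [X in ereal_inf X](_ : _ = set0)%classic.
  exact: ereal_inf0.
apply/seteqP; split=> // _ [delta [delta0 [f [g [_ fg]]]] <-].
have tt : t <= t + delta + delta by rewrite -addrA lerDl addr_ge0.
by have := x_persists _ tt; rewrite -fg (M0 _ (g t k x)) linear0 eqxx.
Qed.

(** * Flag complexes with few vertices *)

Section FewVertices.
Variables (F : fieldType) (V : choiceType) (G : digraph V).
Variables (W : finType) (h : V -> W).
Hypothesis h_inj : injective h.

Lemma clique_size (k : nat) (v : clique G k) : (k <= #|W|)%N.
Proof.
have /andP[/injectiveP v_inj _] := valP v.
by rewrite -[k]card_ord; apply: (leq_card (h \o val v)) => i j /h_inj/v_inj.
Qed.

Lemma flag_chain_eq0 (k : nat) (x : flag_chain F G k) : (#|W| <= k)%N -> x = 0.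
Proof.
move=> Wk; rewrite -(freeg_sumE x) big1_seq // => v _.
by have := leq_trans (clique_size v) Wk; rewrite ltnn.
Qed.

Lemma flag_homology_eq0 (k : nat) (x : homology (dFl F G) k) :
  (#|W| <= k)%N -> x = 0.
Proof.
move=> Wk; have [z ->] := hclassP x.
by apply/hclass_eq0; exists 0; rewrite linear0 [RHS]flag_chain_eq0.
Qed.

End FewVertices.

(** * A sphere on three mutually adjacent vertices *)

Section Word.
Variables (V : choiceType) (G : digraph V).

(** The vertices are distinct because an arc is never a loop. *)
Fact word_subproof (k : nat) (s : k.-tuple V) :
  pairwise G s -> is_clique G [ffun i => tnth s i].
Proof.
move=> sG; have arcs (i j : 'I_k) : (i < j)%N -> G (tnth s i) (tnth s j).
  move=> ij; have x0 := tnth s i.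
  by rewrite !(tnth_nth x0) (pairwiseP x0 sG) ?inE ?size_tuple.
apply/andP; split; last first.
  by apply/forallP => i; apply/forallP => j; rewrite !ffunE; apply/implyP/arcs.
apply/injectiveP => i j; rewrite !ffunE => ij; apply/val_inj.
by case: (ltngtP i j) => // /arcs; rewrite ij arc_irr.
Qed.

Definition word (k : nat) (s : k.-tuple V) (sG : pairwise G s) : clique G k :=
  Sub [ffun i => tnth s i] (word_subproof sG).

End Word.

Section Suspension.
Variables (F : fieldType) (V : choiceType) (G : digraph V) (a b c : V).
Hypotheses (ab : G a b) (ba : G b a) (ac : G a c) (ca : G c a).
Hypotheses (bc : G b c) (cb : G c b).

Lemma word2_subproof x y : G x y -> pairwise G [tuple x; y].
Proof. by move=> xy; rewrite /= xy. Qed.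

Lemma word3_subproof x y z :
  G x y -> G x z -> G y z -> pairwise G [tuple x; y; z].
Proof. by move=> xy xz yz; rewrite /= xy xz yz. Qed.

Definition word2 x y (xy : G x y) := word (word2_subproof xy).
Definition word3 x y z (xy : G x y) (xz : G x z) (yz : G y z) :=
  word (word3_subproof xy xz yz).

Lemma word3_bd x y z (xy : G x y) (xz : G x z) (yz : G y z) :
  flag_bd F G 2 << word3 xy xz yz >> =
  << word2 yz >> - << word2 xz >> + << word2 xy >>.
Proof.
rewrite /= liftU scale1r /flag_face_sum !big_ord_recl big_ord0 /=.
rewrite expr0 scale1r expr1 scaleN1r sqrrN expr1n scale1r addr0 addrA.
by congr (<< _ >> - << _ >> + << _ >>); apply/val_inj/ffunP => -[[|[|]] //] ?;
  rewrite /= !ffunE.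
Qed.

(** The sum of the two cones over the circle [bc + cb], with apex [a] put first
    and put last; it is a cycle over every field, and it uses only three
    vertices because the two apexes need not be distinct. *)
Definition suspension : flag_chain F G 2 :=
  << word3 ab ac bc >> + << word3 ac ab cb >>
  - (<< word3 bc ba ca >> + << word3 cb ca ba >>).

(** Both cones have boundary [bc + cb]. *)
Lemma suspension_bd : flag_bd F G 2 suspension = 0.
Proof.
apply/eqP; rewrite linearB subr_eq0 !linearD !word3_bd; apply/eqP.
rewrite [in LHS](addrAC << word2 cb >>) [in LHS]addrACA subrr addr0.
rewrite [in LHS]addrACA addNr addr0.
by rewrite [in RHS]addrACA [in RHS]subrKA subrr add0r.
Qed.

(** The four words are distinct, so [abc] has coefficient 1. *)
Lemma suspension_neq0 : suspension != 0.
Proof.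
have neq x y : G x y -> x != y.
  by move=> xy; apply: contraTneq xy => ->; rewrite arc_irr.
(* each of the other three words differs from [abc] in its first two letters *)
have word3_eq x y z (xy : G x y) (xz : G x z) (yz : G y z) :
    x != a \/ y != b -> (word3 xy xz yz == word3 ab ac bc) = false.
  move=> xy_ab; apply/eqP => /(congr1 val)/ffunP E.
  have := E 0; have := E 1; rewrite /= !ffunE /= => Eb Ea.
  by case: xy_ab => /eqP; [exact | exact].
apply: contra_neq (oner_neq0 F) => /(congr1 (coeff (word3 ab ac bc))).
rewrite coeff0 coeffB !coeffD !coeffU eqxx !word3_eq ?mulr0 ?mulr1;
  by [rewrite !addr0 subr0 | left; rewrite neq | right; rewrite neq].
Qed.

End Suspension.

Lemma flag_incl_suspension (F : fieldType) (V : choiceType) (G H : digraph V)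
    (GH : subdigraph G H) (a b c : V)
    (ab : G a b) (ba : G b a) (ac : G a c) (ca : G c a)
    (bc : G b c) (cb : G c b) :
  flag_incl F GH 2 (suspension F ab ba ac ca bc cb) =
  suspension F (GH _ _ ab) (GH _ _ ba) (GH _ _ ac)
               (GH _ _ ca) (GH _ _ bc) (GH _ _ cb).
Proof.
have incl_word3 x y z (xy : G x y) (xz : G x z) (yz : G y z) :
    flag_incl F GH 2 << word3 xy xz yz >> =
    << word3 (GH _ _ xy) (GH _ _ xz) (GH _ _ yz) >>.
  by rewrite /= liftU scale1r; congr (<< _ >>); apply/val_inj.
by rewrite linearB; congr (_ - _); rewrite linearD !incl_word3.
Qed.

(** * Halving one edge of the directed 2-cycle *)

Lemma SP_arc_edge (R : realType) (G : wdigraph R) (t : R) (e : edge G) :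
  weight e <= t -> SP G t (src e) (tgt e).
Proof.
move=> et; apply/andP; split; first exact: edge_loopless.
apply/asboolP; exists e, [::]; split; first by rewrite /is_path /= !eqxx.
by rewrite /path_length big_seq1.
Qed.

Lemma SP_arc_edge2 (R : realType) (G : wdigraph R) (t : R) (e f : edge G) :
  tgt e = src f -> src e != tgt f -> weight e + weight f <= t ->
  SP G t (src e) (tgt f).
Proof.
move=> ef ne eft; apply/andP; split=> //; apply/asboolP; exists e, [:: f].
split; first by rewrite /is_path /= ef !eqxx.
by rewrite /path_length big_cons big_seq1.
Qed.

Section Example.
Variable (R : realType).

Fact barycenter_subproof d :
  (forall i : 'I_d.+1, 0 < (d.+1%:R : R)^-1) /\
  \sum_(i < d.+1) (d.+1%:R : R)^-1 = 1.
Proof.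
split=> [_|]; first by rewrite invr_gt0 ltr0n.
by rewrite sumr_const card_ord -[LHS]mulr_natr mulVf // pnatr_eq0.
Qed.

Definition barycenter d : int_simplex R d := exist _ _ (barycenter_subproof d).

Fact two_cycle_inj : injective (fun e : bool => (e, ~~ e)).
Proof. by move=> e e' []. Qed.

Fact two_cycle_loopless (e : bool) : e != ~~ e.
Proof. by case: e. Qed.

Definition two_cycle : wdigraph R :=
  WDigraph two_cycle_inj two_cycle_loopless (fun _ => @ltr01 R).

(** As [true] and [false] are the numbers 1 and 0, this inserts a vertex in the
    middle of the edge from [true] to [false] and keeps the other edge. *)
Definition halving : subdivision two_cycle :=
  fun e => existT _ (e : nat) (barycenter (e : bool)).

(* [start] -> [middle] -> [finish] -> [start] *)
Notation three_cycle := (subdivide halving).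

Definition start : vertex three_cycle := inl true.
Definition finish : vertex three_cycle := inl false.
Definition middle : vertex three_cycle :=
  inr (Tagged (fun e => 'I_(sdim halving e)) (ord0 : 'I_(sdim halving true))).

Definition three_cycle_name (v : vertex three_cycle) : option bool :=
  if v is inl b then Some b else None.

Lemma three_cycle_name_inj : injective three_cycle_name.
Proof.
have no_middle : 'I_(sdim halving false) -> False by case.
move=> [x|[[] x]] [y|[[] y]] //=;
  try by [case: (no_middle x) | case: (no_middle y)].
- by case=> ->.
- by rewrite (ord1 x) (ord1 y).
Qed.

Lemma three_cycle_weight_le1 (e : edge three_cycle) : weight e <= 1.
Proof.
by case: e => e i; rewrite /= /sub_weight /= mulr1 invf_le1 ?ler1n ?ltr0n.
Qed.

Lemma three_cycle_vertexP (v : vertex three_cycle) :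
  [|| v == start, v == finish | v == middle].
Proof.
by rewrite -!(inj_eq three_cycle_name_inj); case: three_cycle_name => [[]|].
Qed.

(** Two consecutive edges suffice to join any two vertices, and no edge is
    longer than 1. *)
Lemma SP_three_cycle (t : R) (x y : vertex three_cycle) : 2 <= t ->
  x != y -> SP three_cycle t x y.
Proof.
move=> t2.
(* [e] and [f] are the halves of the subdivided edge, [g] is the other edge *)
pose e : edge three_cycle :=
  Tagged (fun e => 'I_(sdim halving e).+1) (ord0 : 'I_(sdim halving true).+1).
pose f : edge three_cycle :=
  Tagged (fun e => 'I_(sdim halving e).+1)
         (ord_max : 'I_(sdim halving true).+1).
pose g : edge three_cycle :=
  Tagged (fun e => 'I_(sdim halving e).+1) (ord0 : 'I_(sdim halving false).+1).
have [se sf sg] : [/\ src e = start, src f = middle & src g = finish].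
  by split=> //; exact: (@sub_vS _ _ halving true ord0).
have [te tf tg] : [/\ tgt e = middle, tgt f = finish & tgt g = start].
  by split; [exact: (@sub_vS _ _ halving true ord0) | exact: sub_v_last
            | exact: sub_v_last].
have arc1 h : SP three_cycle t (src h) (tgt h).
  apply: SP_arc_edge; apply: le_trans (three_cycle_weight_le1 h) _.
  by rewrite (le_trans _ t2) // ler1n.
have arc2 h h' : tgt h = src h' -> src h != tgt h' ->
    SP three_cycle t (src h) (tgt h').
  move=> hh' ne; apply: (SP_arc_edge2 hh' ne); apply: le_trans t2.
  by rewrite lerD ?three_cycle_weight_le1.
case/or3P: (three_cycle_vertexP x) => /eqP->;
case/or3P: (three_cycle_vertexP y) => /eqP->; rewrite ?eqxx // => ne.
- by rewrite -se -tf; apply: arc2; rewrite ?te ?sf ?se ?tf.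
- by rewrite -se -te.
- by rewrite -sg -tg.
- by rewrite -sg -te; apply: arc2; rewrite ?tg ?se ?sg ?te.
- by rewrite -sf -tg; apply: arc2; rewrite ?tf ?sg ?sf ?tg.
- by rewrite -sf -tf.
Qed.

End Example.

Theorem proposition6p11 (R : realType) (F : fieldType) :
  exists (G : wdigraph R) (S : subdivision G),
    dI (HdFl F (SP G)) (HdFl F (SP (subdivide S))) = +oo%E.
Proof.
exists (two_cycle R), (@halving R).
pose G3 := SP (subdivide (@halving R)) 2.
have arc x y : x != y -> G3 x y by exact: SP_three_cycle.
pose z : flag_chain F G3 2 := suspension F
  (arc (start R) (middle R) isT) (arc (middle R) (start R) isT)
  (arc (start R) (finish R) isT) (arc (finish R) (start R) isT)
  (arc (middle R) (finish R) isT) (arc (finish R) (middle R) isT).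
have z_cycle : is_cycle (C := dFl F G3) (k := 2) z.
  by apply/eqP; exact: suspension_bd.
pose zc : Defs.cycle (dFl F G3) 2 := Sub z z_cycle.
(* the class of the suspension lives at time 2, when the 3-cycle has become a
   complete digraph *)
apply: (@dI_pinfty _ _ (HdFl F _) (HdFl F _) 2 2 (hclass zc)) => [s y|s s2].
  by apply: (@flag_homology_eq0 _ _ _ bool id) => //; rewrite card_bool.
apply/eqP; rewrite /= homology_mapE => /hclass_eq0[c].
rewrite [c](@flag_chain_eq0 _ _ _ _ _ (@three_cycle_name_inj R)); last first.
  by rewrite card_option card_bool.
rewrite linear0 [RHS]flag_incl_suspension => /esym/eqP.
exact/negP/suspension_neq0.
Qed.
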